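(* Let $\mathcal{G}$ be a hereditary graph class that does not contain all clique partition graphs. Then $\mathcal{G}$ is $(\mathrm{tw},\omega)$-bounded if and only if $\mathcal{G}$ has bounded tree-independence number.
   Context: All graphs are finite, simple and undirected. A class is hereditary if it is closed under taking induced subgraphs. A clique partition graph is a disjoint union of complete graphs. A tree decomposition of $G$ is a pair $(T,\{X_t\}_{t\in V(T)})$ with $T$ a tree and bags $X_t\subseteq V(G)$ such that every vertex lies in some bag, every edge has both endpoints in some bag, and for each vertex $v$ the nodes whose bags contain $v$ induce a connected subtree. The tree-independence number $\mathsf{tree}\text{-}\alpha(G)$ is the minimum over tree decompositions of $\max_t\alpha(G[X_t])$; a class has bounded tree-independence number if some constant bounds it for all members. A class $\mathcal{G}$ is $(\mathrm{tw},\omega)$-bounded if there is a function $f:\mathbb{N}\to\mathbb{N}$ such that for every $G\in\mathcal{G}$ and every induced subgraph $G'$ of $G$, $\mathrm{tw}(G')\le f(\omega(G'))$, where $\mathrm{tw}$ is treewidth and $\omega$ clique number. *)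

(* Defs.v *)
From mathcomp Require Import all_boot.
From mathcomp Require Import boolp.

Set Implicit Arguments.
Unset Strict Implicit.
Unset Printing Implicit Defensive.

Record sgraph := SGraph {
  vertex :> finType;
  adj : rel vertex;
  adj_sym : symmetric adj;
  adj_irrefl : irreflexive adj
}.

Definition isomorphic (G H : sgraph) : Prop :=
  exists f : G -> H, bijective f /\ forall x y, adj (f x) (f y) = adj x y.

Section Induced.
Variables (G : sgraph) (S : {set G}).

Definition induced_adj : rel {x : G | x \in S} :=
  fun x y => adj (val x) (val y).

Lemma induced_adj_sym : symmetric induced_adj.
Proof. by move=> x y; apply: adj_sym. Qed.

Lemma induced_adj_irrefl : irreflexive induced_adj.
Proof. by move=> x; apply: adj_irrefl. Qed.

Definition induced : sgraph := SGraph induced_adj_sym induced_adj_irrefl.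
End Induced.

Section Complete.
Variable n : nat.

Definition complete_adj : rel 'I_n := fun x y => x != y.

Lemma complete_adj_sym : symmetric complete_adj.
Proof. by move=> x y; rewrite /complete_adj eq_sym. Qed.

Lemma complete_adj_irrefl : irreflexive complete_adj.
Proof. by move=> x; rewrite /complete_adj eqxx. Qed.

Definition complete_graph : sgraph :=
  SGraph complete_adj_sym complete_adj_irrefl.
End Complete.

Section DisjointUnion.
Variables (I : finType) (G : I -> sgraph).

(* [tagged_as u v] is the component of [v] transported to [G (tag u)]; it is
   meaningful only when the tags agree. *)
Definition disjoint_union_adj : rel {i : I & G i} :=
  fun u v => (tag u == tag v) && adj (tagged u) (tagged_as u v).

Lemma disjoint_union_adj_sym : symmetric disjoint_union_adj.
Proof.
move=> [i x] [j y]; rewrite /disjoint_union_adj /= eq_sym.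
case: eqP => //= eji; move: x; case: i / eji => x.
by rewrite !tagged_asE adj_sym.
Qed.

Lemma disjoint_union_adj_irrefl : irreflexive disjoint_union_adj.
Proof.
by move=> [i x]; rewrite /disjoint_union_adj /= tagged_asE adj_irrefl andbF.
Qed.

Definition disjoint_union : sgraph :=
  SGraph disjoint_union_adj_sym disjoint_union_adj_irrefl.
End DisjointUnion.

Definition clique_partition_graph (G : sgraph) : Prop :=
  exists (I : finType) (n : I -> nat),
    isomorphic G (disjoint_union (fun i => complete_graph (n i))).

Definition is_stable (G : sgraph) (S : {set G}) : bool :=
  [forall x in S, forall y in S, ~~ adj x y].

Definition is_clique (G : sgraph) (S : {set G}) : bool :=
  [forall x in S, forall y in S, (x != y) ==> adj x y].

Definition independence_number (G : sgraph) : nat :=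
  \max_(S : {set G} | is_stable S) #|S|.

Definition clique_number (G : sgraph) : nat :=
  \max_(S : {set G} | is_clique S) #|S|.

Definition connected_graph (G : sgraph) : Prop :=
  0 < #|G| /\ forall x y : G, connect (@adj G) x y.

Definition acyclic_graph (G : sgraph) : Prop :=
  forall c : seq G, 2 < size c -> ~ ucycle (@adj G) c.

Definition is_tree (T : sgraph) : Prop := connected_graph T /\ acyclic_graph T.

Record is_tree_decomposition (G T : sgraph) (X : T -> {set G}) : Prop := {
  td_tree : is_tree T;
  td_vertex : forall v : G, exists t : T, v \in X t;
  td_edge : forall u v : G, adj u v -> exists t : T, (u \in X t) && (v \in X t);
  td_connected : forall v : G, connected_graph (induced [set t | v \in X t])
}.

(* The predecessor is truncated: the graph without vertices gets width 0
   instead of -1. *)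
Definition td_width (G T : sgraph) (X : T -> {set G}) : nat :=
  (\max_(t : T) #|X t|).-1.

Definition td_independence_number (G T : sgraph) (X : T -> {set G}) : nat :=
  \max_(t : T) independence_number (induced (X t)).

Lemma trivial_tree_decomposition (G : sgraph) :
  is_tree_decomposition (fun _ : complete_graph 1 => [set: G]).
Proof.
split.
- split; first by split=> [|x y]; [rewrite card_ord | rewrite !ord1 connect0].
  move=> c c_gt2 /andP[_ /card_uniqP c_uniq].
  by move: (max_card (mem c)); rewrite c_uniq card_ord leqNgt ltnW.
- by move=> v; exists ord0; rewrite inE.
- by move=> u v _; exists ord0; rewrite !inE.
- move=> v; have v0 : ord0 \in [set t : complete_graph 1 | v \in [set: G]].
    by rewrite !inE.
  split; first by apply/card_gt0P; exists (exist _ ord0 v0).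
  move=> x y; suff -> : x = y by rewrite connect0.
  by apply: val_inj; rewrite !ord1.
Qed.

Definition treewidth_value (G : sgraph) : pred nat := fun k =>
  `[< exists (T : sgraph) (X : T -> {set G}),
        is_tree_decomposition X /\ td_width X = k >].

Definition tree_alpha_value (G : sgraph) : pred nat := fun k =>
  `[< exists (T : sgraph) (X : T -> {set G}),
        is_tree_decomposition X /\ td_independence_number X = k >].

Lemma treewidth_value_ex (G : sgraph) : exists k, treewidth_value G k.
Proof.
eexists; apply/asboolP; exists (complete_graph 1), (fun=> setT).
by split; [apply: trivial_tree_decomposition |].
Qed.

Lemma tree_alpha_value_ex (G : sgraph) : exists k, tree_alpha_value G k.
Proof.
eexists; apply/asboolP; exists (complete_graph 1), (fun=> setT).
by split; [apply: trivial_tree_decomposition |].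
Qed.

Definition treewidth (G : sgraph) : nat := ex_minn (treewidth_value_ex G).

Definition tree_alpha (G : sgraph) : nat := ex_minn (tree_alpha_value_ex G).

(* A class of graphs is understood up to isomorphism. *)
Record graph_class := GraphClass {
  in_class :> sgraph -> Prop;
  in_class_iso : forall G H, isomorphic G H -> in_class G -> in_class H
}.

Definition hereditary (C : graph_class) : Prop :=
  forall G : sgraph, C G -> forall S : {set G}, C (induced S).

Definition contains_all_clique_partition_graphs (C : graph_class) : Prop :=
  forall G : sgraph, clique_partition_graph G -> C G.

Definition tw_omega_bounded (C : graph_class) : Prop :=
  exists f : nat -> nat, forall G : sgraph, C G -> forall S : {set G},
    treewidth (induced S) <= f (clique_number (induced S)).

Definition bounded_tree_alpha (C : graph_class) : Prop :=
  exists k : nat, forall G : sgraph, C G -> tree_alpha G <= k.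

(* Main.v *)
From mathcomp Require Import all_boot zify.
From mathcomp Require Import boolp.
Require Import Defs.

Set Implicit Arguments.
Unset Strict Implicit.
Unset Printing Implicit Defensive.

(** If all bags have independence number at most [k], Ramsey's theorem bounds
    their size in terms of the clique number.

    Conversely, let [G] be in a (tw, omega)-bounded class excluding some clique
    partition graph. For suitable [s] and [p], [G] has no more than [s] pairwise
    anticomplete [s]-cliques and, [K_{p,p}] having clique number 2 and large
    treewidth, no induced [K_{p,p}]. It suffices to find a set [D] of bounded
    independence number meeting all [s]-cliques: [G - D] then has bounded
    treewidth, and [D] can be added to all bags.

    For any weights on the [s]-cliques, some set [Z] of bounded independence
    number meets a constant fraction of the weight. Indeed, a positive fraction
    of the [s]-cliques [Q] touch a positive fraction of the others, hence contain
    a vertex [v] whose closed neighbourhood meets a positive fraction of them.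
    If these vertices [v] contain no large stable set, they form [Z].
    Otherwise let [J] be such a stable set and [Z] the set of vertices with at
    least [p] neighbours in [J]: averaging over [J] shows that [Z] is heavy, and
    a large stable set in [Z] would give an induced [K_{p,p}] by pigeonhole.

    Multiplicative weights turn this into a sequence of sets [Z] such that every
    [s]-clique is met by a constant fraction of them, and [D] consists of the
    vertices lying in a constant fraction of the sets of the sequence. *)

(** * Treewidth and minimum degree *)

(** Paths inside [U] stay on the vertices of [G], so [U] can shrink without a change of type. *)
Definition restricted_adj (G : sgraph) (U : {set G}) : rel G :=
  [rel x y | [&& x \in U, y \in U & adj x y]].

Lemma connect_induced (G : sgraph) (U : {set G}) (x y : induced U) :
  connect (@adj (induced U)) x y ->
  connect (restricted_adj U) (val x) (val y).
Proof.
case/connectP => p; elim: p x => [|z p IHp] x /=; first by move=> _ ->.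
case/andP=> xz /IHp{}IHp /IHp; apply: connect_trans; apply: connect1.
by apply/and3P; split; [apply: (valP x) | apply: (valP z) | ].
Qed.

(* If every vertex of U had two neighbours in U, paths could be prolonged
   forever at their first vertex. *)
Lemma acyclic_leaf (T : sgraph) (U : {set T}) (t0 : T) :
  acyclic_graph T -> t0 \in U ->
  exists2 t, t \in U & forall y z, y \in U -> z \in U ->
    adj t y -> adj t z -> y = z.
Proof.
move=> acT t0U; apply: contrapT => noleaf.
have branch t : t \in U -> exists y z,
    [/\ y \in U, z \in U, adj t y, adj t z & y != z].
  move=> tU; apply: contrapT => nobr; apply: noleaf; exists t => // y z yU zU ty tz.
  by apply/eqP; apply: contraT => yz; case: nobr; exists y, z.
have grow n : exists x p, [/\ size p = n, x \in U, path (@adj T) x p & uniq (x :: p)].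
  elim: n => [|n [x [p [sp xU xp up]]]]; first by exists t0, [::].
  (* A neighbour of [x] further along [p] would close a cycle with at least three vertices. *)
  have nocycle z : adj x z -> z \in p -> z = head z p.
    move=> xz zp; apply/eqP; apply: contraT => zh.
    case/splitPr: zp up xp zh sp => p1 p2.
    rewrite -!cat_rcons -cat_cons cat_uniq cat_path rcons_path.
    move=> /andP[up1 _] /andP[/andP[xp1 lz] _] zh _.
    case: (acT (x :: rcons p1 z)).
      by case: p1 zh {xp1 lz up1} => [|a p1] //=; rewrite ?eqxx // size_rcons.
    rewrite /ucycle /= !rcons_path last_rcons xp1 lz adj_sym xz /=.
    by [].
  have [y [z [yU zU xy xz yz]]] := branch x xU.
  have ext w : w \in U -> adj x w -> w \notin p ->
      exists x p, [/\ size p = n.+1, x \in U, path (@adj T) x p & uniq (x :: p)].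
    move=> wU xw wp; exists w, (x :: p); split => //=; first by rewrite sp.
      by rewrite adj_sym xw.
    move: up => /= ->; rewrite inE negb_or wp !andbT.
    by apply: contraTneq xw => ->; rewrite adj_irrefl.
  case yp: (y \in p); last by apply: (ext y) => //; rewrite yp.
  case zp: (z \in p); last by apply: (ext z) => //; rewrite zp.
  case/eqP: yz; rewrite (nocycle y) // (nocycle z) //.
  by case: (p) yp.
have [x [p [sp _ _ up]]] := grow #|T|.
by move: (max_card (mem (x :: p))); rewrite (card_uniqP up) /= sp ltnn.
Qed.

(** A simple path through [t] would enter and leave it by the same neighbour. *)
Lemma connect_avoid_leaf (T : sgraph) (W : {set T}) (t x y : T) :
  (forall a b, a \in W -> b \in W -> adj t a -> adj t b -> a = b) ->
  x != t -> y != t ->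
  connect (restricted_adj W) x y -> connect (restricted_adj (W :\ t)) x y.
Proof.
move=> leaf xt yt /connectP[p0 /shortenP[p xp up _] ylast] {p0}.
have tp : t \notin p.
  apply/negP => tp; case/splitPr: tp up xp ylast => p1 [|b p2].
    by rewrite last_cat /= => _ _ E; rewrite E eqxx in yt.
  rewrite -cat_cons cat_uniq => /and3P[_ /hasPn /(_ b)].
  rewrite [b \in _]inE mem_head orbT => /(_ isT) bp1 _.
  rewrite cat_path => /andP[_ /= /and3P[/and3P[aW _ at_] /and3P[_ bW tb] _]] _.
  move: bp1 => /=; rewrite -(leaf (last x p1) b aW bW _ tb) 1?adj_sym //.
  by rewrite mem_last.
apply/connectP; exists p => //; move: xt tp xp.
elim: p x {up ylast} => //= z p IHp x xt; rewrite inE negb_or => /andP[tz tp].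
case/andP=> /and3P[xW zW xz] zp; rewrite IHp 1?eq_sym // andbT.
by rewrite /restricted_adj /= !inE xt xW zW xz eq_sym tz.
Qed.

(** Prune leaves of [T]. Either the bag at a leaf has a vertex in no other remaining bag, hence
    contains all its neighbours, or all its vertices lie in the adjacent bag and the leaf can be
    deleted. *)
Lemma bag_contains_closed_neighborhood (G T : sgraph) (X : T -> {set G}) (v0 : G) :
  is_tree_decomposition X ->
  exists v t, v \in X t /\ forall u, adj v u -> u \in X t.
Proof.
case=> -[_ acT] cover edge conn.
suff main n (U : {set T}) : #|U| <= n ->
    (forall v, exists2 t, t \in U & v \in X t) ->
    (forall u v, adj u v -> exists2 t, t \in U & (u \in X t) && (v \in X t)) ->
    (forall v x y, x \in U -> y \in U -> v \in X x -> v \in X y ->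
       connect (restricted_adj (U :&: [set t | v \in X t])) x y) ->
    exists v t, v \in X t /\ forall u, adj v u -> u \in X t.
  apply: (main _ [set: T] (leqnn _)) => [v|u v /edge[t]|v x y _ _ vx vy].
  - by have [t] := cover v; exists t.
  - by exists t.
  have xS : x \in [set t | v \in X t] by rewrite inE.
  have yS : y \in [set t | v \in X t] by rewrite inE.
  rewrite setTI; exact: (connect_induced ((conn v).2 (exist _ x xS) (exist _ y yS))).
elim: n U => [|n IHn] U cardU Ucover Uedge Uconn.
  have [t tU _] := Ucover v0.
  by move: cardU; rewrite leqn0 cards_eq0 => /eqP U0; rewrite U0 inE in tU.
have [t0 t0U _] := Ucover v0.
have [t tU leaf] := acyclic_leaf acT t0U.
have [[v vt vN]|noleaf] := pselect (exists2 v, v \in X t &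
    forall t', t' \in U -> adj t t' -> v \notin X t').
  exists v, t; split=> // u /Uedge[t2 t2U /andP[vt2 ut2]].
  (* A path from [t] to another node [t2] through bags containing [v] would start with a neighbour
     of [t]. *)
  suff -> : t = t2 by [].
  have /connectP[[|a p] /=] := Uconn v t t2 tU t2U vt vt2; first by [].
  case/andP=> /and3P[_]; rewrite !inE => /andP[aU va] ta _ _.
  by rewrite (negPf (vN a aU ta)) in va.
have move_up v : v \in X t -> exists t', [/\ t' \in U, adj t t' & v \in X t'].
  move=> vt; apply: contrapT => nov; apply: noleaf; exists v => // t' t'U tt'.
  by apply/negP => vt'; apply: nov; exists t'.
have neq t' : adj t t' -> t' != t by apply: contraTneq => ->; rewrite adj_irrefl.
apply: (IHn (U :\ t)).
- by rewrite (cardsD1 t U) tU in cardU.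
- move=> v; have [t' t'U vt'] := Ucover v; case: (eqVneq t' t) => [E|t't].
    rewrite E in vt'; have [t2 [t2U /neq tt2 vt2]] := move_up v vt'.
    by exists t2; rewrite // !inE tt2.
  by exists t'; rewrite // !inE t't.
- move=> u v /Uedge[t' t'U uvt']; case: (eqVneq t' t) => [E|t't].
    rewrite E in uvt'; case/andP: uvt' => ut vt.
    have [t1 [t1U tt1 ut1]] := move_up u ut.
    have [t2 [t2U tt2 vt2]] := move_up v vt.
    (* The leaf [t] has only one neighbour in [U], so its bag contains both ends of the edge. *)
    have E12 := leaf _ _ t1U t2U tt1 tt2.
    by exists t1; rewrite ?inE ?neq // ut1 E12.
  by exists t'; rewrite // !inE t't.
move=> v x y; rewrite !inE => /andP[xt xU] /andP[yt yU] vx vy.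
rewrite setIDAC; apply: connect_avoid_leaf => //; last exact: Uconn.
by move=> a b /setIP[aU _] /setIP[bU _]; apply: leaf.
Qed.

Lemma treewidthP (G : sgraph) :
  exists (T : sgraph) (X : T -> {set G}),
    is_tree_decomposition X /\ td_width X = treewidth G.
Proof. by rewrite /treewidth; case: ex_minnP => m /asboolP. Qed.

Lemma treewidth_min (G T : sgraph) (X : T -> {set G}) :
  is_tree_decomposition X -> treewidth G <= td_width X.
Proof.
move=> tdX; rewrite /treewidth; case: ex_minnP => m _; apply.
by apply/asboolP; exists T, X.
Qed.

Lemma tree_alphaP (G : sgraph) :
  exists (T : sgraph) (X : T -> {set G}),
    is_tree_decomposition X /\ td_independence_number X = tree_alpha G.
Proof. by rewrite /tree_alpha; case: ex_minnP => m /asboolP. Qed.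

Lemma tree_alpha_min (G T : sgraph) (X : T -> {set G}) :
  is_tree_decomposition X -> tree_alpha G <= td_independence_number X.
Proof.
move=> tdX; rewrite /tree_alpha; case: ex_minnP => m _; apply.
by apply/asboolP; exists T, X.
Qed.

Lemma min_degree_le_treewidth (G : sgraph) (v0 : G) d :
  (forall v : G, d <= #|[set u | adj v u]|) -> d <= treewidth G.
Proof.
move=> deg; have [T [X [tdX <-]]] := treewidthP G.
have [v [t [vt Nvt]]] := bag_contains_closed_neighborhood v0 tdX.
(* The vertex [v] itself makes up for the 1 subtracted in the width. *)
rewrite /td_width -ltnS (leq_trans (n := #|X t|)) //; last first.
  by apply: leq_trans (leqSpred _); apply: (leq_bigmax t).
have : v |: [set u | adj v u] \subset X t.
  by rewrite subUset sub1set vt /=; apply/subsetP => u; rewrite inE; apply: Nvt.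
by move/subset_leq_card; apply: leq_trans; rewrite cardsU1 inE adj_irrefl ltnS.
Qed.

(** * Independence and clique numbers of vertex sets *)

Lemma stableP (G : sgraph) (S : {set G}) :
  reflect {in S &, forall x y, ~~ adj x y} (is_stable S).
Proof.
apply: (iffP forall_inP) => [H x y xS yS|H x xS]; last first.
  by apply/forall_inP => y; apply: H.
by move/forall_inP: (H x xS); apply.
Qed.

Lemma cliqueP (G : sgraph) (S : {set G}) :
  reflect {in S &, forall x y, x != y -> adj x y} (is_clique S).
Proof.
apply: (iffP forall_inP) => [H x y xS yS|H x xS]; last first.
  by apply/forall_inP => y yS; apply/implyP; apply: H.
by move/forall_inP: (H x xS) => /(_ y yS) /implyP.
Qed.

Lemma stable_subset (G : sgraph) (A B : {set G}) :
  A \subset B -> is_stable B -> is_stable A.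
Proof. by move=> /subsetP AB /stableP H; apply/stableP => x y /AB xB /AB; apply: H. Qed.

Definition alpha_le (G : sgraph) (S : {set G}) (k : nat) : Prop :=
  forall J : {set G}, J \subset S -> is_stable J -> #|J| <= k.

Definition omega_le (G : sgraph) (S : {set G}) (k : nat) : Prop :=
  forall K : {set G}, K \subset S -> is_clique K -> #|K| <= k.

Section InducedSets.
Variables (G : sgraph) (S : {set G}).

Lemma card_val_imset (A : {set induced S}) : #|val @: A| = #|A|.
Proof. exact/card_imset/val_inj. Qed.

Lemma val_imset_sub (A : {set induced S}) : val @: A \subset S.
Proof. by apply/subsetP => _ /imsetP[x _ ->]; apply: valP. Qed.

Lemma val_imset_onto (J : {set G}) : J \subset S ->
  exists A : {set induced S}, J = val @: A.
Proof.
move=> /subsetP JS; exists [set x : induced S | val x \in J].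
apply/setP => x; apply/idP/imsetP => [xJ|[y]]; last by rewrite inE => yJ ->.
by exists (exist _ x (JS x xJ)); rewrite ?inE.
Qed.

Lemma stable_val_imset (A : {set induced S}) : is_stable (val @: A) = is_stable A.
Proof.
apply/stableP/stableP => H x y; last first.
  by case/imsetP=> a aA -> /imsetP[b bA ->]; apply: (H a b).
by move=> xA yA; apply: (H (val x) (val y)); apply: imset_f.
Qed.

Lemma clique_val_imset (A : {set induced S}) : is_clique (val @: A) = is_clique A.
Proof.
apply/cliqueP/cliqueP => H x y; last first.
  by case/imsetP=> a aA -> /imsetP[b bA ->] ab; apply: (H a b).
by move=> xA yA xy; apply: (H (val x) (val y)); rewrite ?imset_f.
Qed.

Lemma independence_number_induced k :
  independence_number (induced S) <= k <-> alpha_le S k.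
Proof.
split=> [/bigmax_leqP H J JS stJ|H]; last first.
  apply/bigmax_leqP => A stA; rewrite -card_val_imset.
  by apply: H; rewrite ?val_imset_sub ?stable_val_imset.
have [A EJ] := val_imset_onto JS.
by rewrite EJ card_val_imset H // -stable_val_imset -EJ.
Qed.

Lemma clique_number_induced k :
  clique_number (induced S) <= k <-> omega_le S k.
Proof.
split=> [/bigmax_leqP H J JS clJ|H]; last first.
  apply/bigmax_leqP => A clA; rewrite -card_val_imset.
  by apply: H; rewrite ?val_imset_sub ?clique_val_imset.
have [A EJ] := val_imset_onto JS.
by rewrite EJ card_val_imset H // -clique_val_imset -EJ.
Qed.

End InducedSets.

Lemma exists_subset_card (T : finType) (A : {set T}) n :
  n <= #|A| -> exists2 B : {set T}, B \subset A & #|B| = n.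
Proof.
move=> nA; exists [set x in take n (enum A)].
  by apply/subsetP => x; rewrite inE => /mem_take; rewrite mem_enum.
rewrite cardsE (card_uniqP _) ?take_uniq ?enum_uniq //.
by rewrite size_takel // -cardE.
Qed.

Lemma pigeonhole (T U : finType) (A : {set T}) (f : T -> U) (V : {set U}) k :
  {in A, forall x, f x \in V} -> #|V| * k < #|A| ->
  exists2 u, u \in V & k < #|[set x in A | f x == u]|.
Proof.
move=> fV ltk; apply: contrapT => small.
suff : #|A| <= #|V| * k by rewrite leqNgt ltk.
rewrite -sum1_card (partition_big f (mem V)) //= -sum_nat_const.
apply: leq_sum => u uV; rewrite leqNgt; apply/negP => ku; apply: small.
by exists u => //; rewrite -sum1_card; under eq_bigl do rewrite inE.
Qed.

(** Fix [x] in [S]. As the two smaller powers add up to the given one, either the neighbours or the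
    non-neighbours of [x] are numerous enough for induction, and [x] extends the clique or the
    stable set found there. *)
Lemma ramsey (G : sgraph) a b (S : {set G}) : 2 ^ (a + b) <= #|S| ->
  (exists2 K : {set G}, K \subset S & is_clique K /\ #|K| = a) \/
  (exists2 J : {set G}, J \subset S & is_stable J /\ #|J| = b).
Proof.
have [m] := ubnP (a + b); elim: m a b S => // m IHm [|a] b S.
  move=> _ _; left; exists set0; rewrite ?sub0set ?cards0 //; split => //.
  by apply/cliqueP => x; rewrite inE.
case: b => [|b].
  move=> _ _; right; exists set0; rewrite ?sub0set ?cards0 //; split => //.
  by apply/stableP => x; rewrite inE.
move=> ltm cardS; have /card_gt0P[x xS] : 0 < #|S|.
  by apply: leq_trans cardS; rewrite expn_gt0.
pose N := [set y in S | adj x y]; pose M := [set y in S | (y != x) && ~~ adj x y].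
have NS : N \subset S by apply/subsetP => y; rewrite inE => /andP[].
have MS : M \subset S by apply/subsetP => y; rewrite inE => /andP[].
have cardNM : #|S| <= (#|N| + #|M|).+1.
  have /subset_leq_card : S \subset x |: (N :|: M).
    apply/subsetP => y yS; rewrite !inE yS /=.
    by case: (y == x) => //=; case: (adj x y).
  move/leq_trans; apply; apply: leq_trans (leq_card_setU _ _) _.
  by rewrite cards1 add1n ltnS leq_card_setU.
have pow : 2 ^ (a.+1 + b.+1) = 2 ^ (a + b.+1) + 2 ^ (a.+1 + b).
  by rewrite !addnS addSn !expnS addnn mul2n.
have : 2 ^ (a + b.+1) <= #|N| \/ 2 ^ (a.+1 + b) <= #|M|.
  case: (leqP (2 ^ (a + b.+1)) #|N|) => ?; first by left.
  by right; rewrite pow in cardS; lia.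
case=> [/IHm|/IHm].
- case=> [|[K KN [clK cK]]|[J JN [stJ cJ]]]; first by lia.
    left; have xK : x \notin K.
      by apply/negP => /(subsetP KN); rewrite inE adj_irrefl andbF.
    exists (x |: K); first by rewrite subUset sub1set xS (subset_trans KN).
    rewrite cardsU1 xK cK; split=> //; apply/cliqueP => y z.
    have xa w : w \in K -> adj x w by move/(subsetP KN); rewrite inE => /andP[].
    case/setU1P=> [->|yK] /setU1P[->|zK]; first by rewrite eqxx.
    + by move=> _; apply: xa.
    + by move=> _; rewrite adj_sym xa.
    by move/cliqueP: clK; apply.
  by right; exists J; rewrite ?(subset_trans JN).
case=> [|[K KN [clK cK]]|[J JN [stJ cJ]]]; first by lia.
  by left; exists K; rewrite ?(subset_trans KN).
right; have xJ : x \notin J.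
  by apply/negP => /(subsetP JN); rewrite !inE eqxx andbF.
exists (x |: J); first by rewrite subUset sub1set xS (subset_trans JN).
rewrite cardsU1 xJ cJ; split=> //; apply/stableP => y z.
have xa w : w \in J -> ~~ adj x w.
  by move/(subsetP JN); rewrite inE => /and3P[].
case/setU1P=> [->|yJ] /setU1P[->|zJ]; first by rewrite adj_irrefl.
+ exact: xa.
+ by rewrite adj_sym xa.
by move/stableP: stJ; apply.
Qed.

Lemma card_alpha_omega (G : sgraph) (S : {set G}) a w :
  alpha_le S a -> omega_le S w -> #|S| <= 2 ^ (w.+1 + a.+1).
Proof.
move=> aS wS; rewrite leqNgt; apply/negP => /ltnW /ramsey[].
  by case=> K KS [clK cK]; move: (wS K KS clK); rewrite cK ltnn.
by case=> K KS [clK cK]; move: (aS K KS clK); rewrite cK ltnn.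
Qed.

(** * Weighted families of cliques *)

Definition touch (G : sgraph) (A B : {set G}) : bool :=
  [exists x in A, exists y in B, (x == y) || adj x y].

Lemma touchP (G : sgraph) (A B : {set G}) :
  reflect (exists x y, [/\ x \in A, y \in B & (x == y) || adj x y]) (touch A B).
Proof.
apply: (iffP exists_inP) => [[x xA /exists_inP[y yB xy]]|[x [y [xA yB xy]]]].
  by exists x, y.
by exists x => //; apply/exists_inP; exists y.
Qed.

Lemma touch_sym (G : sgraph) (A B : {set G}) : touch A B = touch B A.
Proof.
by apply/touchP/touchP => -[x [y [xA yB xy]]]; exists y, x;
   rewrite eq_sym adj_sym.
Qed.

(** Distinct members are disjoint and anticomplete. *)
Definition scattered (G : sgraph) (A : {set {set G}}) : Prop :=
  {in A &, forall P Q, touch P Q -> P = Q}.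

Definition biclique_free (G : sgraph) p : Prop :=
  forall J1 J2 : {set G}, is_stable J1 -> is_stable J2 ->
    {in J1 & J2, forall x y, adj x y} -> p <= #|J1| -> p <= #|J2| -> False.

Definition hits (G : sgraph) (Z Q : {set G}) : bool := ~~ [disjoint Z & Q].

Lemma hitsP (G : sgraph) (Z Q : {set G}) :
  reflect (exists2 x, x \in Z & x \in Q) (hits Z Q).
Proof.
rewrite /hits -setI_eq0; apply: (iffP (set0Pn _)) => [[x /setIP[]]|[x xZ xQ]].
  by exists x.
by exists x; apply/setIP.
Qed.

Lemma leq_sum_sub (I : finType) (P Q : pred I) (F : I -> nat) :
  (forall i, P i -> Q i) -> \sum_(i | P i) F i <= \sum_(i | Q i) F i.
Proof.
move=> PQ; rewrite big_mkcond [leqRHS]big_mkcond leq_sum // => i _.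
by case: ifP => // /PQ ->.
Qed.

(** A weighted union bound. *)
Lemma leq_sum_cover (I J : finType) (A : pred I) (B : pred J) (R : I -> J -> bool)
    (F : I -> nat) :
  (forall i, A i -> exists2 j, B j & R i j) ->
  \sum_(i | A i) F i <= \sum_(j | B j) \sum_(i | A i && R i j) F i.
Proof.
move=> cov; under [leqRHS]eq_bigr do rewrite big_mkcondr.
rewrite exchange_big leq_sum // => i /cov[j Bj Rij].
by rewrite (bigD1 j) //= Rij leq_addr.
Qed.

Section HeavyHit.
Variables (G : sgraph) (s p : nat) (F : {set {set G}}) (om : {set G} -> nat).
Hypotheses (s_gt0 : 0 < s) (p_gt0 : 0 < p).
Hypothesis cardF : {in F, forall Q : {set G}, #|Q| = s}.
Hypothesis noF : forall A : {set {set G}}, A \subset F -> scattered A -> #|A| <= s.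
Hypothesis noK : biclique_free G p.

Let W := \sum_(Q in F) om Q.
Let touched (A : {set G}) := \sum_(Q in F | touch A Q) om Q.
(** Heavy cliques touch at least a fraction 1/(2s) of the total weight, centers at least
    1/(2s^2). *)
Let heavy := [set Q in F | W <= 2 * s * touched Q].
Let center := [set v | W <= 2 * s ^ 2 * touched [set v]].

(* A maximal scattered family of light sets touches all light sets. *)
Lemma heavy_weight : W <= 2 * \sum_(Q in heavy) om Q.
Proof.
pose L := F :\: heavy.
have LF : L \subset F by apply: subsetDl.
pose light_scattered := [pred A : {set {set G}} | (A \subset L) && `[< scattered A >]].
have /ex_maxset[A /maxsetP[/andP[AL /asboolP scA] maxA]] :
    exists A, light_scattered A.
  exists set0; rewrite /= sub0set.
  by apply/asboolP => P Q; rewrite inE.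
have cover Q : Q \in L -> exists2 P, P \in A & touch P Q.
  move=> QL; apply: contrapT => notouch.
  have QA : Q |: A = A.
    apply: maxA; last exact: subsetUr.
    rewrite /= subUset sub1set QL AL; apply/asboolP => P1 P2.
    case/setU1P=> [->|P1A] /setU1P[->|P2A] // t12.
    - by case: notouch; exists P2; rewrite // touch_sym.
    - by case: notouch; exists P1.
    exact: scA.
  have QinA : Q \in A by rewrite -QA setU11.
  apply: notouch; exists Q => //; apply/touchP.
  have /card_gt0P[x xQ] : 0 < #|Q| by rewrite cardF // (subsetP LF).
  by exists x, x; rewrite eqxx.
have W_split : W = \sum_(Q in heavy) om Q + \sum_(Q in L) om Q.
  rewrite /W (bigID (mem heavy)) /=; congr addn.
    by apply: eq_bigl => Q; rewrite !inE; case: (Q \in F).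
  by apply: eq_bigl => Q; rewrite !inE andbC.
have L_le : \sum_(Q in L) om Q <= \sum_(P in A) touched P.
  apply: leq_trans (leq_sum_cover (R := fun Q P => touch P Q) _ cover) _.
  apply: leq_sum => P PA; apply: leq_sum_sub => Q /andP[/(subsetP LF) QF ->].
  by rewrite QF.
(* Each of the at most [s] members of [A] touches less than W/(2s), so the light sets weigh at most
   W/2. *)
have : 2 * s * \sum_(P in A) touched P <= #|A| * W.
  rewrite big_distrr /= -sum_nat_const leq_sum // => P /(subsetP AL).
  by rewrite !inE => /andP[H PF]; move: H; rewrite PF /= -ltnNge => /ltnW.
have := noF (subset_trans AL LF) scA.
by nia.
Qed.

(** Otherwise the [s] vertices of [Q] would each touch less than W/(2s^2), and [Q] less than
    W/(2s). *)
Lemma center_hits_heavy Q : Q \in heavy -> hits center Q.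
Proof.
rewrite inE => /andP[QF Wle]; have cQ := cardF QF.
apply: contrapT => nohit.
have light v : v \in Q -> 2 * s ^ 2 * touched [set v] < W.
  move=> vQ; rewrite ltnNge; apply/negP => vc; apply: nohit; apply/hitsP.
  by exists v; rewrite // inE.
have tQ : touched Q <= \sum_(v in Q) touched [set v].
  apply: (leq_trans (leq_sum_cover (R := fun P v => touch [set v] P) (B := mem Q) _ _)).
    move=> P /andP[_ /touchP[x [y [xQ yP xy]]]]; exists x => //.
    by apply/touchP; exists x, y; rewrite inE eqxx.
  by apply: leq_sum => v _; apply: leq_sum_sub => P /andP[/andP[-> _] ->].
(* The summand [s] records one strict inequality per vertex of [Q]. *)
have : 2 * s ^ 2 * \sum_(v in Q) touched [set v] + s <= s * W.
  rewrite -{2 3}cQ -sum_nat_const -sum1_card big_distrr -big_split /=.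
  by apply: leq_sum => v /light; rewrite addn1.
by nia.
Qed.

(** At most [p] vertices for each possible neighbourhood in a stable set of size 4s^3p. *)
Definition hit_alpha := p * 2 ^ (4 * s ^ 3 * p).

Lemma heavy_hit : exists Z : {set G}, alpha_le Z hit_alpha /\
  \sum_(Q in F) om Q <= 4 * s ^ 2 * \sum_(Q in F | hits Z Q) om Q.
Proof.
pose n := 4 * s ^ 3 * p.
have n_le : n <= hit_alpha.
  by rewrite /hit_alpha -/n; apply: leq_trans (ltnW (ltn_expl n (ltnSn 1))) _; nia.
have [small|] := pselect (alpha_le center n).
  exists center; split=> [J JZ stJ|]; first exact: leq_trans (small J JZ stJ) n_le.
  have : \sum_(Q in heavy) om Q <= \sum_(Q in F | hits center Q) om Q.
    apply: leq_sum_sub => Q Qh; rewrite center_hits_heavy // andbT.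
    by move: Qh; rewrite inE => /andP[].
  by have := heavy_weight; rewrite -/W; nia.
move=> /existsNP[J0 /not_implyP[J0c /not_implyP[stJ0 /negP]]].
rewrite -ltnNge => /ltnW /exists_subset_card[J JJ0 cJ].
have stJ := stable_subset JJ0 stJ0; have Jc := subset_trans JJ0 J0c.
pose N u := [set v in J | adj u v].
pose Z := [set u | p <= #|N u|]; exists Z; split.
  move=> I IZ stI; rewrite leqNgt; apply/negP => big.
  (* More than [p] vertices of [I] share a neighbourhood [M] in [J], and [M] has at least [p]
     elements: a forbidden biclique. *)
  have : #|powerset J| * p < #|I| by rewrite card_powerset cJ mulnC.
  case/(pigeonhole (f := N)).
    by move=> u _; rewrite inE; apply/subsetP => v; rewrite inE => /andP[].
  move=> M _; set I' := [set x in I | N x == M] => ltp.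
  have /card_gt0P[u0 u0I'] : 0 < #|I'| by apply: leq_trans ltp.
  have [u0I EM] : u0 \in I /\ N u0 = M.
    by move: u0I'; rewrite inE => /andP[? /eqP].
  apply: (noK (J1 := I') (J2 := M)); last 2 [exact: ltnW].
  - by apply: stable_subset stI; apply/subsetP => x; rewrite inE => /andP[].
  - apply: stable_subset stJ; rewrite -EM.
    by apply/subsetP => x; rewrite inE => /andP[].
  - by move=> x y; rewrite inE => /andP[_ /eqP <-]; rewrite inE => /andP[].
  by move/(subsetP IZ): u0I; rewrite inE EM.
pose deg Q := #|[set v in J | touch [set v] Q]|.
(* Double counting of the pairs of a center in [J] and a clique touching its closed neighbourhood's
   vertex set is replaced here by summing [touched] over [J]. *)
have nW : n * W <= 2 * s ^ 2 * \sum_(Q in F) om Q * deg Q.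
  have -> : \sum_(Q in F) om Q * deg Q = \sum_(v in J) touched [set v].
    rewrite /touched; under [RHS]eq_bigr do rewrite big_mkcondr.
    rewrite exchange_big /=; apply: eq_bigr => Q QF.
    rewrite -big_mkcondr /deg mulnC -sum_nat_const.
    by apply: eq_bigl => v; rewrite inE.
  rewrite -cJ -sum_nat_const big_distrr leq_sum //= => v /(subsetP Jc).
  by rewrite inE.
have deg_le Q : deg Q <= n.
  by rewrite -cJ subset_leq_card //; apply/subsetP => v; rewrite inE => /andP[].
(* A vertex of [Q] in [J] touches only itself in the stable set [J]; one outside [J] and [Z] has
   fewer than [p] neighbours there. *)
have deg_small Q : Q \in F -> ~~ hits Z Q -> deg Q <= s * p.
  move=> QF nohit; rewrite -(cardF QF) -sum_nat_const.
  have sub : [set v in J | touch [set v] Q] \subset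
      \bigcup_(u in Q) [set v in J | (u == v) || adj u v].
    apply/subsetP => v; rewrite inE => /andP[vJ /touchP[x [y [/set1P-> yQ xy]]]].
    by apply/bigcupP; exists y; rewrite // inE vJ eq_sym adj_sym.
  apply: leq_trans (subset_leq_card sub) _.
  apply: leq_trans (_ : \sum_(u in Q) #|[set v in J | (u == v) || adj u v]| <= _).
    elim/big_ind2: _ => [|A a B b Aa Bb|//]; first by rewrite cards0.
    by apply: leq_trans (leq_card_setU _ _) (leq_add Aa Bb).
  apply: leq_sum => u uQ; case: (boolP (u \in J)) => uJ.
    apply: leq_trans p_gt0; rewrite -(cards1 u) subset_leq_card //.
    apply/subsetP => v; rewrite !inE => /andP[vJ]; rewrite eq_sym; case/orP=> // uv.
    by move/stableP: stJ => /(_ u v uJ vJ); rewrite uv.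
  have : ~~ (p <= #|N u|).
    by apply: contra nohit => pN; apply/hitsP; exists u; rewrite // inE.
  rewrite -ltnNge => /ltnW; apply: leq_trans; apply: subset_leq_card.
  apply/subsetP => v; rewrite !inE => /andP[vJ]; rewrite vJ /=.
  by case/orP=> // /eqP uv; rewrite uv vJ in uJ.
have : \sum_(Q in F) om Q * deg Q <=
    n * (\sum_(Q in F | hits Z Q) om Q) + s * p * W.
  rewrite big_mkcondr /W !big_distrr -big_split leq_sum //= => Q QF.
  case: ifPn => [_|/(deg_small Q QF)].
    by have := deg_le Q; nia.
  by nia.
rewrite -/W; set H := \sum_(Q in F | _) _; set D := \sum_(Q in F) _ => DH.
have : n * W <= 2 * s ^ 2 * (n * H + s * p * W).
  by apply: leq_trans nW _; rewrite leq_mul2l DH orbT.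
have n_gt0 : 0 < n by rewrite /n !muln_gt0 s_gt0 p_gt0.
(* This choice of [n] makes the cliques missed by [Z] account for at most half of n * W. *)
have En : n = 2 * (2 * s ^ 2 * (s * p)) by rewrite /n; lia.
move=> key; have : n * W <= n * (4 * s ^ 2 * H).
  by rewrite {1}En; rewrite En in key *; nia.
by rewrite leq_pmul2l.
Qed.

End HeavyHit.

(** * Multiplicative weights *)

(** Bernoulli's inequality (1 + 1/b)^n >= 1 + n/b with denominators cleared. *)
Lemma bernoulli_nat b n : b ^ n * (b + n) <= b.+1 ^ n * b.
Proof.
elim: n => [|n IHn]; first by rewrite addn0.
have H : b * (b + n.+1) <= b.+1 * (b + n) by nia.
apply: leq_trans (_ : b ^ n * (b.+1 * (b + n)) <= _).
  by rewrite expnSr -mulnA leq_mul2l H orbT.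
by rewrite mulnCA expnS -mulnA leq_mul2l IHn orbT.
Qed.

Lemma double_expn b : 0 < b -> 2 * b ^ b <= b.+1 ^ b.
Proof.
move=> b_gt0; rewrite -(leq_pmul2r b_gt0); apply: leq_trans (bernoulli_nat b b).
by rewrite addnn -mul2n; lia.
Qed.

(** With b = 2a - 1, after 2b rounds the bound on the potential has fallen by a factor (1 +
    1/b)^(2b) >= 4 relative to doubling in every round. *)
Definition boost_rounds a := (2 * a).-1 * 2.

Section Boosting.
Variables (I : finType) (Z : eqType) (F : {set I}) (hit : Z -> I -> bool).
Variables (good : Z -> Prop) (a : nat).
Hypothesis a_gt0 : 0 < a.
Hypothesis weak : forall om : I -> nat, exists2 z, good z &
  \sum_(i in F) om i <= a * \sum_(i in F | hit z i) om i.

(* Doubling the weight of the elements missed in each round makes the total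
   weight grow by a factor 2 - 1/a only. *)
Lemma boosting_potential T : exists zs : seq Z,
  [/\ size zs = T, {in zs, forall z, good z} &
   a ^ T * \sum_(i in F) 2 ^ count (fun z => ~~ hit z i) zs
     <= (2 * a).-1 ^ T * #|F|].
Proof.
elim: T => [|T [zs [szs gzs pot]]].
  by exists [::]; split=> //; rewrite sum1_card.
have [z gz wz] := weak (fun i => 2 ^ count (fun z => ~~ hit z i) zs).
exists (z :: zs); split; first by rewrite /= szs.
  by move=> y; rewrite inE => /predU1P[->|/gzs].
move: wz pot; set S := \sum_(i in F) _; set H := \sum_(i in F | _) _ => wz pot.
have -> : \sum_(i in F) 2 ^ count (fun z => ~~ hit z i) (z :: zs) = 2 * S - H.
  have S_split : S = H + \sum_(i in F | ~~ hit z i) 2 ^ count (fun z => ~~ hit z i) zs.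
    by rewrite /S (bigID (hit z)).
  rewrite (bigID (hit z)) /=.
  under eq_bigr => i /andP[_ ->] do rewrite add0n.
  under [X in _ + X = _]eq_bigr => i /andP[_ ->] do rewrite add1n expnS.
  by rewrite -big_distrr /= -/H; lia.
(* This uses the guarantee S <= a * H for [z]. *)
have step : a * (2 * S - H) <= (2 * a).-1 * S by nia.
rewrite !expnSr -mulnA (leq_trans (leq_mul (leqnn _) step)) //.
by rewrite mulnCA [leqRHS]mulnAC [leqRHS]mulnC leq_mul2l pot orbT.
Qed.

(** After [T] rounds the total weight is at most 2^T * |F| / 4^L <= 2^(T - L). An element missed m
    times has weight 2^m, so m <= T - L and it is hit at least [L] times. *)
Lemma boosting : exists (L : nat) (zs : seq Z),
  [/\ 0 < L, size zs = boost_rounds a * L, {in zs, forall z, good z} &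
      {in F, forall i, L <= count (fun z => hit z i) zs}].
Proof.
(* Any positive [L] with |F| <= 2^L would do. *)
pose L := #|F|.+1; pose T := boost_rounds a * L.
have [zs [szs gzs pot]] := boosting_potential T.
exists L, zs; split=> // i iF.
have key : 4 ^ L * (2 * a).-1 ^ T <= 2 ^ T * a ^ T.
  rewrite -expnMn /T /boost_rounds; set b := (2 * a).-1.
  have Eb : 2 * a = b.+1 by rewrite /b; lia.
  have b_gt0 : 0 < b by rewrite /b; lia.
  rewrite Eb !(expnM _ _ L) -expnMn leq_exp2r // !(expnM _ _ 2).
  by rewrite -[4]/(2 ^ 2) -expnMn leq_exp2r // double_expn.
have FL : #|F| <= 2 ^ L by apply: ltnW; apply: leq_trans (ltn_expl _ _) .
have miss : 2 ^ count (fun z => ~~ hit z i) zs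
    <= \sum_(i in F) 2 ^ count (fun z => ~~ hit z i) zs.
  by rewrite (bigD1 i iF) leq_addr.
have : 2 ^ (L + count (fun z => ~~ hit z i) zs) <= 2 ^ T.
  have aT : 0 < a ^ T by rewrite expn_gt0 a_gt0.
  have p2 : 0 < 2 ^ L by rewrite expn_gt0.
  move: miss pot key; rewrite -[4]/(2 * 2) expnMn expnD.
  move: (2 ^ count _ _) (\sum_(i in F) _) ((2 * a).-1 ^ T) (a ^ T) (2 ^ T) (2 ^ L)
    aT p2 FL.
  move=> m S B A T2 P A0 P0 FP mS pot key.
  rewrite -(leq_pmul2r A0) -(leq_pmul2r P0).
  apply: leq_trans (_ : P * P * (B * #|F|) <= _).
    apply: leq_trans (_ : P * P * (A * S) <= _); last by rewrite leq_mul2l pot orbT.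
    by have := leq_mul (leqnn (P * P * A)) mS; lia.
  apply: leq_trans (_ : P * P * B * P <= _).
    by rewrite mulnA leq_mul2l FP orbT.
  by rewrite leq_mul2r key orbT.
by rewrite leq_exp2l // -szs -(count_predC (fun z => hit z i)) leq_add2r.
Qed.

End Boosting.

(** * Hitting sets of bounded independence number *)

Lemma sum_count (T : finType) (A : {set T}) (zs : seq {set T}) :
  \sum_(v in A) count (fun Z : {set T} => v \in Z) zs = \sum_(Z <- zs) #|Z :&: A|.
Proof.
under eq_bigr do rewrite -sum1_count big_mkcond.
rewrite exchange_big /=; apply: eq_bigr => Z _.
by rewrite -big_mkcondr sum1dep_card; apply: eq_card => v; rewrite !inE andbC.
Qed.

(** The length of the sequence is proportional to [L], which depends on [F]; the threshold L/s for
    membership in [D] cancels it. *)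
Definition hitting_alpha s p :=
  s * (boost_rounds (4 * s ^ 2) * hit_alpha s p).

Lemma hitting_set (G : sgraph) s p (F : {set {set G}}) :
  0 < s -> 0 < p -> {in F, forall Q : {set G}, #|Q| = s} ->
  (forall A : {set {set G}}, A \subset F -> scattered A -> #|A| <= s) ->
  biclique_free G p ->
  exists2 D : {set G}, alpha_le D (hitting_alpha s p) & {in F, forall Q, hits D Q}.
Proof.
move=> s_gt0 p_gt0 cardF noF noK.
have [||L [zs [L_gt0 szs gzs Lzs]]] := @boosting _ _ F (@hits G)
    (fun Z => alpha_le Z (hit_alpha s p)) (4 * s ^ 2).
- by rewrite muln_gt0 expn_gt0 s_gt0.
- by move=> om; have [Z [? ?]] := heavy_hit om s_gt0 p_gt0 cardF noF noK; exists Z.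
pose D := [set v | L <= s * count (fun Z : {set G} => v \in Z) zs].
exists D.
  move=> J JD stJ; rewrite -(leq_pmul2r L_gt0).
  apply: leq_trans (_ : s * \sum_(v in J) count (fun Z : {set G} => v \in Z) zs <= _).
    rewrite -sum_nat_const big_distrr leq_sum //= => v /(subsetP JD).
    by rewrite inE.
  rewrite sum_count /hitting_alpha -mulnA leq_mul2l; apply/orP; right.
  rewrite mulnAC -szs -sum1_size big_distrl /= big_seq [leqRHS]big_seq.
  apply: leq_sum => Z /gzs Zgood; rewrite mul1n Zgood ?subsetIl //.
  by apply: stable_subset stJ; apply: subsetIr.
move=> Q QF; apply: contrapT => nohit.
(* If all [s] vertices of [Q] lay in fewer than L/s sets, fewer than [L] sets would hit [Q]. *)
have small v : v \in Q -> s * count (fun Z : {set G} => v \in Z) zs < L.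
  move=> vQ; rewrite ltnNge; apply/negP => Lv; apply: nohit.
  by apply/hitsP; exists v; rewrite // inE.
have : L <= \sum_(v in Q) count (fun Z : {set G} => v \in Z) zs.
  apply: leq_trans (Lzs Q QF) _; rewrite sum_count -sum1_count.
  rewrite big_mkcond leq_sum //= => Z _.
  by case: ifP => // /hitsP[x xZ xQ]; apply/card_gt0P; exists x; apply/setIP.
have : s * (\sum_(v in Q) count (fun Z : {set G} => v \in Z) zs) + s <= s * L.
  rewrite -{2 3}(cardF Q QF) -sum_nat_const -sum1_card big_distrr -big_split /=.
  by apply: leq_sum => v /small; rewrite addn1.
by nia.
Qed.

(** * Transfer between tree decompositions and graph classes *)

Lemma restrict_tree_decomposition (G T : sgraph) (X : T -> {set G}) (S : {set G}) :
  is_tree_decomposition X ->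
  is_tree_decomposition (fun t => [set x : induced S | val x \in X t]).
Proof.
case=> treeT cover edge conn; split=> //.
- by move=> v; have [t vt] := cover (val v); exists t; rewrite inE.
- by move=> u v /edge[t]; exists t; rewrite !inE.
move=> v; have -> : [set t | v \in [set x : induced S | val x \in X t]] =
    [set t | val v \in X t] by apply/setP => t; rewrite !inE.
exact: conn.
Qed.

Lemma connected_induced_setT (T : sgraph) :
  connected_graph T -> connected_graph (induced [set: T]).
Proof.
case=> /card_gt0P[t _] conn; split.
  by apply/card_gt0P; exists (exist _ t (in_setT t)).
move=> [x xT] [y yT]; have /connectP[p xp ylast] := conn x y.
apply/connectP; exists [seq exist _ z (in_setT z) | z <- p].
  elim: p x xT xp {ylast} => //= z p IHp x xT /andP[xz /IHp->].
  by rewrite andbT; apply: xz.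
apply: val_inj; rewrite /= {}ylast {xp}.
by elim: p x xT => //= z p IHp x xT; apply: IHp.
Qed.

(** Vertices of [D] occupy the whole tree; the others keep their nodes. *)
Lemma extend_tree_decomposition (G T : sgraph) (D : {set G})
    (X : T -> {set induced (~: D)}) :
  is_tree_decomposition X ->
  is_tree_decomposition (fun t => val @: X t :|: D).
Proof.
case=> treeT cover edge conn.
have [[/card_gt0P[t0 _] connT] _] := treeT.
have inX v (vD : v \in ~: D) t : (v \in val @: X t :|: D) = (exist _ v vD \in X t).
  have /negPf vD' : v \notin D by rewrite -in_setC.
  rewrite inE vD' orbF.
  apply/imsetP/idP => [[x xt E]|vt]; last by exists (exist _ v vD).
  by have -> : exist _ v vD = x by apply: val_inj.
split=> //.
- move=> v; case: (boolP (v \in D)) => [vD|]; first by exists t0; rewrite inE vD orbT.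
  rewrite -in_setC => vD; have [t vt] := cover (exist _ v vD).
  by exists t; rewrite (inX v vD).
- move=> u v uv; case: (boolP (u \in D)) => [uD|].
    case: (boolP (v \in D)) => [vD|]; first by exists t0; rewrite !inE uD vD !orbT.
    rewrite -in_setC => vD; have [t vt] := cover (exist _ v vD).
    by exists t; rewrite (inX v vD) vt inE uD orbT.
  rewrite -in_setC => uD; case: (boolP (v \in D)) => [vD|].
    have [t ut] := cover (exist _ u uD).
    by exists t; rewrite (inX u uD) ut inE vD orbT.
  rewrite -in_setC => vD.
  have [t uvt] := edge (exist _ u uD) (exist _ v vD) uv.
  by exists t; rewrite (inX u uD) (inX v vD).
move=> v; case: (boolP (v \in D)) => [vD|].
  have -> : [set t | v \in val @: X t :|: D] = setT.
    by apply/setP => t; rewrite !inE vD orbT.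
  by apply: connected_induced_setT; case: treeT.
rewrite -in_setC => vD.
have -> : [set t | v \in val @: X t :|: D] = [set t | exist _ v vD \in X t].
  by apply/setP => t; rewrite !inE -(inX v vD) !inE.
exact: conn.
Qed.

(** A stable set in an extended bag has at most [a] vertices in [D], and the rest lie in a bag of
    size at most the treewidth plus 1. *)
Lemma tree_alpha_deletion (G : sgraph) (D : {set G}) a :
  alpha_le D a -> tree_alpha G <= (treewidth (induced (~: D))).+1 + a.
Proof.
move=> aD; have [T [X [tdX Ew]]] := treewidthP (induced (~: D)).
apply: leq_trans (tree_alpha_min (extend_tree_decomposition tdX)) _.
apply/bigmax_leqP => t _; apply/independence_number_induced => J JX stJ.
rewrite -(cardsID D J) addnC leq_add //; last first.
  by apply: aD; [apply: subsetIr | apply: stable_subset stJ; apply: subsetIl].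
rewrite -Ew; apply: leq_trans (leqSpred _).
apply: leq_trans (leq_bigmax t); rewrite -card_val_imset subset_leq_card //.
apply/subsetP => x /setDP[/(subsetP JX)]; rewrite inE => /orP[//|xD].
by rewrite xD.
Qed.

Lemma treewidth_le_ramsey (G : sgraph) k (S : {set G}) :
  tree_alpha G <= k ->
  treewidth (induced S) <= 2 ^ ((clique_number (induced S)).+1 + k.+1).
Proof.
have [T [X [tdX <-]]] := tree_alphaP G => /bigmax_leqP ak.
apply: leq_trans (treewidth_min (restrict_tree_decomposition S tdX)) _.
apply: leq_trans (leq_pred _) _; apply/bigmax_leqP => t _.
have /clique_number_induced wS := leqnn (clique_number (induced S)).
have /independence_number_induced aX := ak t isT.
rewrite -card_val_imset; apply: card_alpha_omega => [J JX|K KX].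
  apply: aX; apply: subset_trans JX _.
  by apply/subsetP => _ /imsetP[x + ->]; rewrite inE.
by apply: wS; apply: subset_trans KX (val_imset_sub _).
Qed.

Lemma bounded_tree_alpha_tw_omega_bounded (C : graph_class) :
  bounded_tree_alpha C -> tw_omega_bounded C.
Proof.
case=> k Ck; exists (fun w => 2 ^ (w.+1 + k.+1)) => G CG S.
exact/treewidth_le_ramsey/Ck.
Qed.

(** A clique meets each stable side at most once, and every vertex is adjacent to the whole opposite
    side. *)
Lemma biclique_treewidth (G : sgraph) (J1 J2 : {set G}) p :
  0 < p -> is_stable J1 -> is_stable J2 -> {in J1 & J2, forall x y, adj x y} ->
  p <= #|J1| -> p <= #|J2| ->
  clique_number (induced (J1 :|: J2)) <= 2 /\ p <= treewidth (induced (J1 :|: J2)).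
Proof.
move=> p_gt0 st1 st2 J12 p1 p2; split.
  apply/clique_number_induced => K KJ clK.
  have one J : is_stable J -> #|K :&: J| <= 1.
    move=> stJ; apply/card_le1_eqP => x y /setIP[xK xJ] /setIP[yK yJ].
    apply/eqP; apply: contraT => xy.
    move/stableP: stJ => /(_ x y xJ yJ); case/negP.
    by move/cliqueP: clK; apply; rewrite // eq_sym.
  have -> : K = (K :&: J1) :|: (K :&: J2) by rewrite -setIUr; apply/esym/setIidPl.
  by apply: leq_trans (leq_card_setU _ _) (leq_add (one _ st1) (one _ st2)).
have /card_gt0P[x xJ1] : 0 < #|J1| by apply: leq_trans p1.
have xU : x \in J1 :|: J2 by rewrite inE xJ1.
apply: (min_degree_le_treewidth (exist _ x xU : induced (J1 :|: J2))) => -[v vU].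
suff [J JU [pJ vJ]] : exists2 J : {set G}, J \subset J1 :|: J2 &
    p <= #|J| /\ {in J, forall u, adj v u}.
  have [A EA] := val_imset_onto JU.
  apply: leq_trans pJ _; rewrite EA card_val_imset subset_leq_card //.
  by apply/subsetP => u uA; rewrite inE; apply: vJ; rewrite EA imset_f.
case/setUP: (vU) => vJ.
  by exists J2; rewrite ?subsetUr //; split=> // u; apply: J12.
by exists J1; rewrite ?subsetUl //; split=> // u uJ; rewrite adj_sym J12.
Qed.

(** * Excluding a clique partition graph *)

Section ExcludedCliquePartition.
Variables (G : sgraph) (I : finType) (n : I -> nat).
Let P := disjoint_union (fun i => complete_graph (n i)).

(** Assign distinct members of [A] to the components and choose [n i] vertices in each;
    scatteredness excludes edges between components. *)
Lemma clique_partition_embedding s (A : {set {set G}}) :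
  #|I| <= s -> (forall i, n i <= s) -> scattered A -> s <= #|A| ->
  {in A, forall Q : {set G}, is_clique Q /\ #|Q| = s} ->
  exists S : {set G}, isomorphic (induced S) P.
Proof.
move=> Is ns scA sA clA.
have IA i : enum_rank i < #|A| := leq_trans (leq_trans (ltn_ord _) Is) sA.
pose q i := enum_val (Ordinal (IA i)).
have qA i : q i \in A by apply: enum_valP.
have q_inj : injective q.
  by move=> i j /enum_val_inj /(congr1 val) /= /val_inj /enum_rank_inj.
have nq i (x : 'I_(n i)) : x < #|q i|.
  by rewrite (clA _ (qA i)).2; apply: leq_trans (ns i).
pose f (u : P) : G := enum_val (Ordinal (nq (tag u) (tagged u))).
have fq u : f u \in q (tag u) by apply: enum_valP.
have tag_eq u v : (f u == f v) || adj (f u) (f v) -> tag u = tag v.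
  move=> uv; apply: q_inj; apply: scA => //.
  by apply/touchP; exists (f u), (f v).
have f_inj : injective f.
  move=> u v E; have := @tag_eq u v; rewrite E eqxx => /(_ isT).
  case: u v E => [i x] [j y] + /= Eij; case: j / Eij y => y E.
  by congr existT; apply: val_inj; move/enum_val_inj: E => /(congr1 val).
have f_adj u v : adj (f u) (f v) = adj u v.
  have -> : adj u v = (tag u == tag v) && (u != v).
    case: u v => [i x] [j y]; rewrite /adj /= /disjoint_union_adj /=.
    by case: eqP => //= E; case: j / E y => y; rewrite tagged_asE eq_Tagged.
  case: (eqVneq (tag u) (tag v)) => [E|ne] /=.
    case: (eqVneq u v) => [->|uv]; first by rewrite adj_irrefl.
    have [/cliqueP cl _] := clA _ (qA (tag u)).
    by apply: cl; rewrite ?(inj_eq f_inj) // E.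
  by apply: contra_neqF ne => uv; apply: tag_eq; rewrite uv orbT.
exists (f @: [set: P]).
have fS u : f u \in f @: [set: P] by apply: imset_f.
pose g (u : P) : induced (f @: [set: P]) := exist _ (f u) (fS u).
have g_inj : injective g by move=> u v /(congr1 val) /f_inj.
have g_onto x : exists u, g u = x.
  by case: x => x xS; case/imsetP: (xS) => u _ Ex; exists u; apply: val_inj.
have [h gh] := choice g_onto.
have hg : cancel g h by move=> u; apply: g_inj; rewrite gh.
exists h; split; first by exists g.
by move=> x y; rewrite -f_adj -[x in RHS]gh -[y in RHS]gh.
Qed.

End ExcludedCliquePartition.

Lemma not_all_clique_partitions (C : graph_class) :
  hereditary C -> ~ contains_all_clique_partition_graphs C ->
  exists2 s, 0 < s & forall G : sgraph, C G -> forall A : {set {set G}},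
    scattered A -> {in A, forall Q : {set G}, is_clique Q /\ #|Q| = s} -> #|A| <= s.
Proof.
move=> hC /existsNP[G0 /not_implyP[[I [n isoG0]] nCG0]].
(* This bounds both the number and the sizes of the components of the excluded graph, and is
   positive. *)
exists (#|I| + \sum_i n i).+1 => // G CG A scA clA; rewrite leqNgt; apply/negP => sA.
have [||S isoS] := clique_partition_embedding (n := n) _ _ scA (ltnW sA) clA.
- by rewrite leqW ?leq_addr.
- by move=> i; rewrite leqW // (bigD1 i) //=; lia.
apply: nCG0; apply: in_class_iso (in_class_iso isoS (hC G CG S)).
have [f [[g fg gf] f_adj]] := isoG0; exists g; split; first by exists f.
by move=> x y; rewrite -f_adj !gf.
Qed.

Lemma tw_omega_bounded_tree_alpha (C : graph_class) :
  hereditary C -> ~ contains_all_clique_partition_graphs C ->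
  tw_omega_bounded C -> bounded_tree_alpha C.
Proof.
move=> hC hP [f Cf]; have [s s_gt0 noS] := not_all_clique_partitions hC hP.
(* A monotone majorant of [f], as clique numbers are only bounded from above. *)
pose f' w := \max_(i < w.+1) f i.
have f'P w i : i <= w -> f i <= f' w.
  by move=> iw; apply: (leq_bigmax (Ordinal (iw : i < w.+1))).
pose p := (f' 2).+1.
exists ((f' s).+1 + hitting_alpha s p) => G CG.
have noK : biclique_free G p.
  move=> J1 J2 st1 st2 J12 p1 p2.
  have [w2 /leq_trans/(_ (Cf G CG _))] := biclique_treewidth (ltn0Sn _) st1 st2 J12 p1 p2.
  by move/leq_trans => /(_ _ (f'P _ _ w2)); rewrite ltnn.
pose F := [set Q : {set G} | is_clique Q && (#|Q| == s)].
have FP Q : Q \in F -> is_clique Q /\ #|Q| = s by rewrite inE => /andP[? /eqP].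
have [||D aD hitD] := @hitting_set G s p F s_gt0 (ltn0Sn _) _ _ noK.
- by move=> Q /FP[].
- by move=> A /subsetP AF scA; apply: noS => // Q /AF /FP.
apply: leq_trans (tree_alpha_deletion aD) _; rewrite leq_add2r ltnS.
apply: leq_trans (Cf G CG _) (f'P _ _ _).
(* A larger clique avoiding [D] would contain an [s]-clique, which [D] hits. *)
apply/clique_number_induced => K KD clK; rewrite leqNgt; apply/negP => /ltnW.
case/exists_subset_card => Q QK cQ.
have /hitD /hitsP[x xD xQ] : Q \in F.
  rewrite inE cQ eqxx andbT; apply/cliqueP => x y /(subsetP QK) xK /(subsetP QK).
  by move/cliqueP: clK; apply.
by have := subsetP KD x (subsetP QK x xQ); rewrite inE xD.
Qed.

Theorem theorem3p2 (C : graph_class)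
    (hC : hereditary C)
    (hP : ~ contains_all_clique_partition_graphs C) :
  tw_omega_bounded C <-> bounded_tree_alpha C.
Proof.
split; first exact: tw_omega_bounded_tree_alpha.
exact: bounded_tree_alpha_tw_omega_bounded.
Qed.
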